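(* Let $a,b,c>0$, $i\in\{0,1\}$, $j\in\{0,1,2,3\}$, and let $\mathcal P_{ij}$ be the set of rectangular parallelepipeds of maximum volume among those that can move around the corner in the spatial corridor $\mathcal S_{ij}=\mathcal C_{ij}\times(0,c)$. Then any $P\in\mathcal P_{ij}$ has volume $abc$ and, up to congruence, $P=R\times(0,c)$ for a rectangle $R\in\mathcal R_{ij}$ which has maximum area among the rectangles in $\mathcal R_{ij}$.
   Context: Fix $a,b,c>0$. In the plane $\mathbb R^2$ with coordinates $(x,y)$ set $\mathcal D=\{x=a,\ 0<y<b\}$, $\mathcal A_0=\mathcal D\cup\{0<x<a\}$, $\mathcal B_0=\mathcal D\cup\{x>a\}$, $\mathcal A_1=\mathcal A_0\cap\{y>0\}$, $\mathcal B_1=\mathcal B_0\cap\{y>0\}$, $\mathcal B_2=\mathcal B_0\cap\{y<b\}$, $\mathcal B_3=\mathcal B_0\cap\{0<y<b\}$, and $\mathcal C_{ij}=\mathcal A_i\cup\mathcal B_j$ for $(i,j)\in\{0,1\}\times\{0,1,2,3\}$. An open rectangle $R$ (with sides in arbitrary directions) ''can move around the corner in $\mathcal C_{ij}$'' if there is a continuous path $\Phi_t$, $t\in[0,1]$, in the Euclidean group $E(2)$ of rigid motions of the plane such that $\Phi_0(R)\subset\mathcal A_i$, $\Phi_1(R)\subset\mathcal B_j$ and $\Phi_t(R)\subset\mathcal C_{ij}$ for all $t\in[0,1]$. $\mathcal R_{ij}$ is the set of all such $R$. Spatial analogue: $\mathcal S_{ij}=\mathcal C_{ij}\times(0,c)\subset\mathbb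 R^3$. An open rectangular parallelepiped $P$ (in arbitrary position) ''can move around the corner in $\mathcal S_{ij}$'' if there is a continuous path $\Phi_t$, $t\in[0,1]$, in the group $E(3)$ of rigid motions of space such that $\Phi_0(P)\subset\mathcal A_i\times(0,c)$, $\Phi_1(P)\subset\mathcal B_j\times(0,c)$ and $\Phi_t(P)\subset\mathcal S_{ij}$ for all $t\in[0,1]$. *)

(* Defs.v *)
From HB Require Import structures.
From mathcomp Require Import all_boot all_order all_algebra.
From mathcomp Require Import all_classical all_reals all_analysis.

Set Implicit Arguments.
Unset Strict Implicit.
Unset Printing Implicit Defensive.

Import Order.TTheory GRing.Theory Num.Theory.
Import numFieldNormedType.Exports.

Local Open Scope classical_set_scope.
Local Open Scope ring_scope.

(* The Euclidean group E(n) = O(n) |x R^n; points are row vectors, so that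
   matrices act on the right. *)
Record rigid_motion (R : realType) (n : nat) := RigidMotion {
  rm_lin : 'M[R]_n;
  rm_trans : 'rV[R]_n;
  rm_orthogonal : rm_lin *m rm_lin^T = 1%:M
}.

Definition rm_act (R : realType) (n : nat) (g : rigid_motion R n)
    (p : 'rV[R]_n) : 'rV[R]_n := p *m rm_lin g + rm_trans g.

(* Continuity on [0, 1] for the topology of E(n) as a subspace of
   'M[R]_n * 'rV[R]_n. *)
Definition rm_path (R : realType) (n : nat) (Phi : R -> rigid_motion R n) :
    Prop :=
  {within `[0%R, 1%R], continuous (fun t => rm_lin (Phi t))} /\
  {within `[0%R, 1%R], continuous (fun t => rm_trans (Phi t))}.

(* Nondegenerate open boxes in arbitrary position: open rectangles for n = 2,
   open rectangular parallelepipeds for n = 3. *)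
Record box (R : realType) (n : nat) := Box {
  box_side : 'I_n -> R;
  box_side_gt0 : forall k, 0 < box_side k;
  box_position : rigid_motion R n
}.

Definition box_set (R : realType) (n : nat) (P : box R n) : set 'rV[R]_n :=
  rm_act (box_position P) @`
    [set p : 'rV[R]_n | forall k, 0 < p ord0 k < box_side P k].

(* Product of the edge lengths; the area when n = 2. *)
Definition volume (R : realType) (n : nat) (P : box R n) : R :=
  \prod_(k < n) box_side P k.

(* P can be moved from A to B inside C. *)
Definition can_move (R : realType) (n : nat) (A B C : set 'rV[R]_n)
    (P : box R n) : Prop :=
  exists Phi : R -> rigid_motion R n,
    [/\ rm_path Phi,
        rm_act (Phi 0) @` box_set P `<=` A,
        rm_act (Phi 1) @` box_set P `<=` B
      & forall t : R, 0 <= t <= 1 -> rm_act (Phi t) @` box_set P `<=` C].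

Definition max_volume (R : realType) (n : nat) (M : set (box R n))
    (P : box R n) : Prop :=
  M P /\ forall Q : box R n, M Q -> volume Q <= volume P.

Definition xc (R : realType) (p : 'rV[R]_2) : R := p ord0 ord0.
Definition yc (R : realType) (p : 'rV[R]_2) : R := p ord0 ord_max.

Definition door (R : realType) (a b : R) : set 'rV[R]_2 :=
  [set p | xc p = a /\ 0 < yc p < b].

Definition regionA0 (R : realType) (a b : R) : set 'rV[R]_2 :=
  door a b `|` [set p | 0 < xc p < a].

Definition regionB0 (R : realType) (a b : R) : set 'rV[R]_2 :=
  door a b `|` [set p | a < xc p].

Definition regionA (R : realType) (a b : R) (i : 'I_2) : set 'rV[R]_2 :=
  match val i with
  | 0%N => regionA0 a b
  | _ => regionA0 a b `&` [set p | 0 < yc p]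
  end.

Definition regionB (R : realType) (a b : R) (j : 'I_4) : set 'rV[R]_2 :=
  match val j with
  | 0%N => regionB0 a b
  | 1%N => regionB0 a b `&` [set p | 0 < yc p]
  | 2%N => regionB0 a b `&` [set p | yc p < b]
  | _ => regionB0 a b `&` [set p | 0 < yc p < b]
  end.

Definition regionC (R : realType) (a b : R) (i : 'I_2) (j : 'I_4) :
    set 'rV[R]_2 :=
  regionA a b i `|` regionB a b j.

(* S x (0, c); 'rV[R]_(2 + 1) is convertible to 'rV[R]_3. *)
Definition cylinder (R : realType) (S : set 'rV[R]_2) (c : R) :
    set 'rV[R]_(2 + 1) :=
  [set p | S (lsubmx p) /\ 0 < rsubmx p ord0 ord0 < c].

Definition planar_movable (R : realType) (a b : R) (i : 'I_2) (j : 'I_4) :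
    set (box R 2) :=
  [set Q | can_move (regionA a b i) (regionB a b j) (regionC a b i j) Q].

Definition spatial_movable (R : realType) (a b c : R) (i : 'I_2) (j : 'I_4) :
    set (box R 3) :=
  [set P | can_move (cylinder (regionA a b i) c) (cylinder (regionB a b j) c)
                    (cylinder (regionC a b i j) c) P].

(* Main.v *)
Require Import Defs.
From mathcomp Require Import all_boot all_order all_algebra.
From mathcomp Require Import all_classical all_reals all_analysis.
From mathcomp Require Import ring lra.

Set Implicit Arguments.
Unset Strict Implicit.
Unset Printing Implicit Defensive.

Import Order.TTheory GRing.Theory Num.Theory.
Import numFieldNormedType.Exports.

Local Open Scope classical_set_scope.
Local Open Scope ring_scope.

(* Let l be the sides of the box and u, w, v the x-, y- and z-components of its
   edge directions, so that the slab gives sum l|v| <= c.  While all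
   b|w_k| < l_k, the box contains segments of length b parallel to the y-axis;
   none of them fits into the door x = a, so the part of the box which they
   fill lies on one side of the plane x = a.  Following the box from A_i to
   B_j, there is a time when l_k = b|w_k| for some k and this part is still on
   the left (or l_k <= b|w_k| already at time 0).  Since
   w = +-(v x u), at that time
     volume = b|w_k| l_m l_n <= b (l_m|v_m| l_n|u_n| + l_n|v_n| l_m|u_m|)
   and the two wall constraints make l_m|u_m| and l_n|u_n| at most a, so the
   volume is at most abc.  Equality forces an edge of length c to be vertical
   at that time.  A box with an edge of length c cannot be tilted slightly
   inside the slab, hence that edge is vertical at all times and the whole
   motion projects to a motion of its rectangular base. *)

(** * Inequalities between edge lengths and edge directions *)

Lemma cross_norm (R : realFieldType) (u1 u2 u3 v1 v2 v3 w1 : R) :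
  u1 ^+ 2 + w1 ^+ 2 + v1 ^+ 2 = 1 ->
  u1 ^+ 2 + u2 ^+ 2 + u3 ^+ 2 = 1 -> v1 ^+ 2 + v2 ^+ 2 + v3 ^+ 2 = 1 ->
  u1 * v1 + u2 * v2 + u3 * v3 = 0 ->
  `|w1| = `|v2 * u3 - v3 * u2|.
Proof.
move=> r1 cu cv cuv.
have e : w1 ^+ 2 = (v2 * u3 - v3 * u2) ^+ 2.
  (* Lagrange's identity. Squares are compared because the determinant may be -1, so [w1] is known
     only up to sign. *)
  have -> : (v2 * u3 - v3 * u2) ^+ 2 =
    (v2 ^+ 2 + v3 ^+ 2) * (u2 ^+ 2 + u3 ^+ 2) - (u2 * v2 + u3 * v3) ^+ 2 by ring.
  have -> : v2 ^+ 2 + v3 ^+ 2 = 1 - v1 ^+ 2 by rewrite -cv; ring.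
  have -> : u2 ^+ 2 + u3 ^+ 2 = 1 - u1 ^+ 2 by rewrite -cu; ring.
  have -> : u2 * v2 + u3 * v3 = - (u1 * v1) by move: cuv; lra.
  have -> : w1 ^+ 2 = 1 - u1 ^+ 2 - v1 ^+ 2 by rewrite -r1; ring.
  ring.
by move/eqP: e; rewrite eqf_sqr => /orP[] /eqP ->; rewrite ?normrN.
Qed.

(** With [Zk] the vertical extent and [Xk] the x-extent of edge k, [cross_norm] bounds the volume by
    [b * (Z2 * X3 + Z3 * X2)], hence by [b * (Z2 + Z3) * a] and by [b * (c - Z1) * a]. Equality
    throughout makes [v1] vanish and leaves either a single vertical edge or [X2 = X3 = a]; the
    hypothesis ending in [False] excludes the latter. *)
Lemma upright_of_volume (R : realFieldType)
    (l1 l2 l3 u1 u2 u3 v1 v2 v3 w1 a b c : R) :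
  0 < l1 -> 0 < l2 -> 0 < l3 -> 0 < a -> 0 < b -> 0 < c ->
  u1 ^+ 2 + w1 ^+ 2 + v1 ^+ 2 = 1 ->
  u1 ^+ 2 + u2 ^+ 2 + u3 ^+ 2 = 1 -> v1 ^+ 2 + v2 ^+ 2 + v3 ^+ 2 = 1 ->
  u1 * v1 + u2 * v2 + u3 * v3 = 0 ->
  l1 * `|v1| + l2 * `|v2| + l3 * `|v3| <= c ->
  l2 * `|u2| <= a -> l3 * `|u3| <= a ->
  (v1 = 0 -> l2 * `|u2| = a -> l3 * `|u3| = a -> False) ->
  l1 <= b * `|w1| -> a * b * c <= l1 * l2 * l3 ->
  a * b * c = l1 * l2 * l3 /\
  (`|v2| = 1 /\ l2 = c \/ `|v3| = 1 /\ l3 = c).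
Proof.
move=> l1p l2p l3p ap bp cp r1 cu cv cuv hc hx2 hx3 hne hw hV.
have hw1 := cross_norm r1 cu cv cuv.
have hw2 : `|w1| <= `|v2| * `|u3| + `|v3| * `|u2|.
  by rewrite hw1 -!normrM ler_normB.
set X2 := l2 * `|u2| in hx2 hne *; set X3 := l3 * `|u3| in hx3 hne *.
set Z1 := l1 * `|v1| in hc; set Z2 := l2 * `|v2| in hc.
set Z3 := l3 * `|v3| in hc.
have [Z1p Z2p Z3p] : [/\ 0 <= Z1, 0 <= Z2 & 0 <= Z3].
  by split; rewrite mulr_ge0 // ltW.
have V1 : l1 * l2 * l3 <= b * (Z2 * X3 + Z3 * X2).
  have -> : b * (Z2 * X3 + Z3 * X2) =
      b * (`|v2| * `|u3| + `|v3| * `|u2|) * l2 * l3.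
    by rewrite /Z2 /Z3 /X2 /X3; ring.
  rewrite ler_pM2r // ler_pM2r //; apply: (le_trans hw).
  by rewrite ler_pM2l.
have V2 : Z2 * X3 + Z3 * X2 <= (Z2 + Z3) * a.
  by rewrite mulrDl lerD // ler_wpM2l.
have V3 : (Z2 + Z3) * a <= (c - Z1) * a by rewrite ler_pM2r //; move: hc; lra.
have V4 : a * c <= Z2 * X3 + Z3 * X2.
  rewrite -(ler_pM2l bp); apply: le_trans V1; move: hV; lra.
have aZ1 : a * Z1 <= 0 by lra.
have Z10 : Z1 = 0.
  by apply/eqP; rewrite eq_le Z1p andbT -(pmulr_rle0 _ ap).
have v10 : v1 = 0.
  move/eqP: Z10; rewrite /Z1 mulf_eq0 gt_eqF //= normr_eq0 => /eqP //.
rewrite Z10 subr0 in V3.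
have Veq : a * b * c = l1 * l2 * l3.
  apply/eqP; rewrite eq_le hV /=; apply: (le_trans V1).
  have -> : a * b * c = b * (c * a) by ring.
  by rewrite ler_pM2l //; lra.
split => //.
(* [V2] is now an equality, and its defect is the sum of the two nonnegative products in [d2] and
   [d3]. *)
have d2 : Z2 * (a - X3) = 0.
  have : 0 <= Z2 * (a - X3) by rewrite mulr_ge0 // subr_ge0.
  have : 0 <= Z3 * (a - X2) by rewrite mulr_ge0 // subr_ge0.
  lra.
have d3 : Z3 * (a - X2) = 0.
  have : 0 <= Z2 * (a - X3) by rewrite mulr_ge0 // subr_ge0.
  have : 0 <= Z3 * (a - X2) by rewrite mulr_ge0 // subr_ge0.
  lra.
have Zc : Z2 + Z3 = c.
  have e : (Z2 + Z3) * a = c * a by lra.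
  by apply: (mulIf (lt0r_neq0 ap)).
have hn (x y z : R) : x = 0 -> y = 0 -> x ^+ 2 + y ^+ 2 + z ^+ 2 = 1 -> `|z| = 1.
  move=> -> -> h; have hz : `|z| ^+ 2 = 1 by rewrite real_normK ?num_real -?h; ring.
  by apply/eqP; rewrite -(@eqrXn2 _ 2) // ?expr1n ?hz // normr_ge0.
have Zv (l v : R) : 0 < l -> l * `|v| = 0 -> v = 0.
  by move=> lp /eqP; rewrite mulf_eq0 gt_eqF //= normr_eq0 => /eqP.
case: (eqVneq Z2 0) => [Z20|Z2n].
  have v20 := Zv _ _ l2p Z20; have v31 := hn _ _ _ v10 v20 cv.
  by right; split => //; move: Zc; rewrite Z20 /Z3 v31; lra.
case: (eqVneq Z3 0) => [Z30|Z3n].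
  have v30 := Zv _ _ l3p Z30.
  have v21 : `|v2| = 1 by apply: (hn v1 v3) => //; rewrite -cv; ring.
  by left; split => //; move: Zc; rewrite Z30 /Z2 v21; lra.
move/eqP: d2; rewrite mulf_eq0 (negPf Z2n) subr_eq0 /= => /eqP d2.
move/eqP: d3; rewrite mulf_eq0 (negPf Z3n) subr_eq0 /= => /eqP d3.
by case: (hne v10).
Qed.

(** Adding the wall and the door inequality eliminates [m]. Since u and w are orthogonal, each |u_k
    w_k| is at most the sum of the other two, so the terms subtracted for the segments of length [b]
    are compensated. If both extents equal [a], all slack vanishes: then [u1 = 0], and with [v1 = 0]
    the first edge is parallel to the y-axis, so [w2 = 0] and the slack of edge 2 is its whole
    extent [a], which is positive. *)
Lemma doorway_extents (R : realFieldType)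
    (l1 l2 l3 u1 u2 u3 v1 w1 w2 w3 m a b : R) :
  0 < l1 -> 0 < l2 -> 0 < l3 -> 0 < a -> 0 < b ->
  u1 ^+ 2 + w1 ^+ 2 + v1 ^+ 2 = 1 ->
  w1 ^+ 2 + w2 ^+ 2 + w3 ^+ 2 = 1 ->
  u1 * w1 + u2 * w2 + u3 * w3 = 0 ->
  0 <= m - (l1 * `|u1| + l2 * `|u2| + l3 * `|u3|) / 2 ->
  m + ((l1 - b * `|w1|) * `|u1| + (l2 - b * `|w2|) * `|u2| +
       (l3 - b * `|w3|) * `|u3|) / 2 <= a ->
  l1 = b * `|w1| -> b * `|w2| <= l2 -> b * `|w3| <= l3 ->
  [/\ l2 * `|u2| <= a, l3 * `|u3| <= a
    & v1 = 0 -> l2 * `|u2| = a -> l3 * `|u3| = a -> False].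
Proof.
move=> l1p l2p l3p ap bp r1 cw cuw m0 ma e1 e2 e3.
have T1 : `|u2 * w2| <= `|u1 * w1| + `|u3 * w3|.
  have -> : u2 * w2 = - (u1 * w1 + u3 * w3) by move: cuw; lra.
  by rewrite normrN ler_normD.
have T2 : `|u3 * w3| <= `|u1 * w1| + `|u2 * w2|.
  have -> : u3 * w3 = - (u1 * w1 + u2 * w2) by move: cuw; lra.
  by rewrite normrN ler_normD.
have bT1 : b * `|u2 * w2| <= b * (`|u1 * w1| + `|u3 * w3|) by rewrite ler_pM2l.
have bT2 : b * `|u3 * w3| <= b * (`|u1 * w1| + `|u2 * w2|) by rewrite ler_pM2l.
rewrite !normrM in bT1 bT2.
have S2 : 0 <= (l2 - b * `|w2|) * `|u2| by rewrite mulr_ge0 // subr_ge0.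
have S3 : 0 <= (l3 - b * `|w3|) * `|u3| by rewrite mulr_ge0 // subr_ge0.
rewrite e1 in m0 ma.
have h2 : l2 * `|u2| + (l3 - b * `|w3|) * `|u3| +
    b / 2 * (`|u1| * `|w1| + `|u3| * `|w3| - `|u2| * `|w2|) <= a by lra.
have h3 : l3 * `|u3| + (l2 - b * `|w2|) * `|u2| +
    b / 2 * (`|u1| * `|w1| + `|u2| * `|w2| - `|u3| * `|w3|) <= a by lra.
split; [by lra | by lra | move=> v10 f2 f3].
have w1p : 0 < `|w1| by rewrite -(pmulr_rgt0 _ bp) -e1.
have u1w1 : b * (`|u1| * `|w1|) = 0.
  have : 0 <= b * (`|u1| * `|w1|) by rewrite mulr_ge0 ?(ltW bp) // mulr_ge0.
  lra.
have u10 : u1 = 0.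
  move/eqP: u1w1; rewrite !mulf_eq0 (gt_eqF bp) (gt_eqF w1p) orbF /= normr_eq0.
  by move/eqP.
have w11 : w1 ^+ 2 = 1 by rewrite -r1 u10 v10; ring.
have w20 : w2 = 0.
  apply/eqP; rewrite -sqrf_eq0 eq_le sqr_ge0 andbT.
  by have := sqr_ge0 w3; move: cw; rewrite w11; lra.
have S20 : (l2 - b * `|w2|) * `|u2| = 0 by lra.
by move: S20; rewrite w20 normr0; lra.
Qed.

(** A small tilt raises the box to first order through the other two edges but lowers the long edge
    only to second order. In formulas, |v1| + |v2| is at least the square root of 1 - |v3|^2, and
    the resulting inequality can be divided by 1 - |v3| unless the edge is vertical. The gap lets
    continuity keep the edge vertical. *)
Lemma upright_gap (R : realFieldType) (l1 l2 c d v1 v2 v3 : R) :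
  0 < d -> d <= l1 -> d <= l2 -> 0 < c ->
  v1 ^+ 2 + v2 ^+ 2 + v3 ^+ 2 = 1 ->
  c * `|v3| + (l1 * `|v1| + l2 * `|v2|) <= c ->
  `|v3| = 1 \/ `|v3| <= 1 - d ^+ 2 / c ^+ 2.
Proof.
move=> dp d1 d2 cp cv hc.
set x := `|v3| in hc *.
have x0 : 0 <= x by exact: normr_ge0.
have nx : x ^+ 2 = v3 ^+ 2 by rewrite /x real_normK ?num_real.
have n1 : `|v1| ^+ 2 = v1 ^+ 2 by rewrite real_normK ?num_real.
have n2 : `|v2| ^+ 2 = v2 ^+ 2 by rewrite real_normK ?num_real.
have p1 : 0 <= `|v1| by []. have p2 : 0 <= `|v2| by [].
have k1 : d * `|v1| <= l1 * `|v1| by rewrite ler_wpM2r.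
have k2 : d * `|v2| <= l2 * `|v2| by rewrite ler_wpM2r.
have k3 : d * (`|v1| + `|v2|) <= c * (1 - x) by lra.
have q1 : 0 <= d * (`|v1| + `|v2|) by rewrite mulr_ge0 ?addr_ge0 // ltW.
have q2 := le_trans q1 k3.
have k4 : d ^+ 2 * (1 - x ^+ 2) <= c ^+ 2 * (1 - x) ^+ 2.
  rewrite -!exprMn; apply: (@le_trans _ _ ((d * (`|v1| + `|v2|)) ^+ 2)).
    rewrite exprMn ler_pM2l ?exprn_gt0 //.
    rewrite sqrrD n1 n2 nx; have := mulr_ge0 p1 p2; move: cv; lra.
  by rewrite ler_sqr ?nnegrE.
have x1 : x <= 1 by move: q2; rewrite pmulr_rge0 // subr_ge0.
case: (eqVneq x 1) => [->|xn]; [by left | right].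
have x1' : 0 < 1 - x by rewrite subr_gt0 lt_neqAle xn.
have k5 : d ^+ 2 * (1 + x) <= c ^+ 2 * (1 - x).
  rewrite -(ler_pM2r x1'); apply: le_trans (le_trans k4 _); first by lra.
  by lra.
rewrite lerBrDr -lerBrDl ler_pdivrMr ?exprn_gt0 //.
have : 0 <= d ^+ 2 * x by rewrite mulr_ge0 // sqr_ge0.
lra.
Qed.

(** * Affine functions on open boxes, and segments that miss the door *)

Lemma box_affine_ge (R : realFieldType) n (l v : 'I_n -> R) (lo tau : R) :
  (forall k, 0 < l k) ->
  (forall p : 'I_n -> R, (forall k, 0 < p k < l k) ->
     lo <= \sum_k p k * v k + tau) ->
  lo <= (\sum_k l k * v k) / 2 + tau - (\sum_k l k * `|v k|) / 2.
Proof.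
move=> lp H; set S := \sum_k l k * `|v k|; set m := (\sum_k l k * v k) / 2.
have S0 : 0 <= S by apply: sumr_ge0 => k _; rewrite mulr_ge0 // ltW.
have He e : 0 < e -> e < 1 -> lo <= m + tau - (1 - e) * S / 2.
  (* The minimising corner is outside the open box; [p] goes from the centre the fraction [1 - e] of
     the way towards it. *)
  move=> e0 e1; pose p k := l k / 2 * (1 - (1 - e) * Num.sg (v k)).
  have -> : m + tau - (1 - e) * S / 2 = \sum_k p k * v k + tau.
    have -> : \sum_k p k * v k = m - (1 - e) * S / 2.
      rewrite /m /S -mulrA mulr_suml mulr_suml mulr_sumr -sumrB.
      by apply: eq_bigr => k _; rewrite /p normrEsg; ring.
    ring.
  apply: H => k; rewrite /p; have lk := lp k; have l2 : 0 < l k / 2 by lra.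
  have -> : l k = l k / 2 * 2 by lra.
  rewrite [X in X * (1 - _)](_ : _ = l k / 2); last by lra.
  rewrite pmulr_rgt0 // ltr_pM2l //.
  by case: sgrP => _; lra.
rewrite leNgt; apply/negP => hlt; set d := lo - (m + tau - S / 2).
have dp : 0 < d by rewrite /d; lra.
have Dp : 0 < S + 2 * d by lra.
(* Small enough that the loss [e * S / 2] stays below the assumed violation [d]; the summand [2 * d]
   keeps the denominator positive when [S = 0] and gives [e < 1]. *)
set e := d / (S + 2 * d).
have ep : 0 < e by rewrite divr_gt0.
have eD : e * (S + 2 * d) = d by rewrite /e divfK // gt_eqF.
have e1 : e < 1 by rewrite ltr_pdivrMr //; lra.
have := He e ep e1; have : 0 < e * d by rewrite mulr_gt0.
rewrite /d in eD dp *; lra.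
Qed.

Lemma box_affine_le (R : realFieldType) n (l v : 'I_n -> R) (hi tau : R) :
  (forall k, 0 < l k) ->
  (forall p : 'I_n -> R, (forall k, 0 < p k < l k) ->
     \sum_k p k * v k + tau <= hi) ->
  (\sum_k l k * v k) / 2 + tau + (\sum_k l k * `|v k|) / 2 <= hi.
Proof.
move=> lp H.
have sN (f : 'I_n -> R) : \sum_k f k * - v k = - \sum_k f k * v k.
  by rewrite -sumrN; apply: eq_bigr => k _; rewrite mulrN.
have := @box_affine_ge _ _ l (fun k => - v k) (- hi) (- tau) lp.
rewrite sN; under [X in _ - X / 2]eq_bigr do rewrite normrN.
move=> h; suff : - hi <= - (\sum_k l k * v k) / 2 - tau -
    (\sum_k l k * `|v k|) / 2 by lra.
by apply: h => p /H; rewrite sN; lra.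
Qed.

(* [m -+ e] is the x-range of the centres of the y-parallel segments of length b
   contained in the box; such a segment does not fit into the door. *)
Lemma doorway_chord (R : realFieldType) n (l u w : 'I_n -> R)
    (a b tx ty : R) :
  let m := (\sum_k l k * u k) / 2 + tx in
  let e := (\sum_k (l k - b * `|w k|) * `|u k|) / 2 in
  0 < b -> \sum_k u k * w k = 0 -> \sum_k u k ^+ 2 = 1 ->
  \sum_k w k ^+ 2 = 1 ->
  (forall k, b * `|w k| < l k) ->
  (forall p : 'I_n -> R, (forall k, 0 < p k < l k) ->
     \sum_k p k * u k + tx = a -> 0 < \sum_k p k * w k + ty < b) ->
  0 < e /\ (m + e <= a \/ a <= m - e).
Proof.
move=> m e bp uw uu ww hl H.
have d0 k : 0 < l k - b * `|w k| by rewrite subr_gt0.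
have ep : 0 < e.
  have ege : 0 <= \sum_k (l k - b * `|w k|) * `|u k|.
    by apply: sumr_ge0 => k _; rewrite mulr_ge0 // ltW.
  rewrite /e divr_gt0 // lt0r ege andbT; apply/eqP => /psumr_eq0P h0.
  have u0 k : u k = 0.
    have /eqP : (l k - b * `|w k|) * `|u k| = 0.
      by apply: h0 => // i _; rewrite mulr_ge0 // ltW.
    by rewrite mulf_eq0 (gt_eqF (d0 k)) /= normr_eq0 => /eqP.
  move: uu; rewrite big1 => [/eqP|k _]; last by rewrite u0 expr0n.
  by rewrite eq_sym oner_eq0.
split => //; apply/orP; rewrite !leNgt -negb_and; apply/negP => /andP[h1 h2].
set r := (a - m) / e.
have re : r * e = a - m by rewrite /r divfK // gt_eqF.
have r1 : r < 1 by rewrite /r ltr_pdivrMr //; lra.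
have r2 : -1 < r by rewrite /r ltr_pdivlMr //; lra.
(* For [s = 1] and [s = -1] these are the ends of a segment of length [b] parallel to the y-axis;
   [r] puts its centre, hence all of it, on x = a. Two points of the open door cannot differ in
   height by [b]. *)
pose q s k := l k / 2 + s * (b * w k / 2) +
  r * Num.sg (u k) * (l k - b * `|w k|) / 2.
have qin s : `|s| = 1 -> forall k, 0 < q s k < l k.
  move=> s1 k; have dk := d0 k.
  have A1 : `|s * (b * w k / 2)| <= b * `|w k| / 2.
    by rewrite !normrM s1 mul1r (gtr0_norm bp) [`|2^-1|]ger0_norm // invr_ge0.
  have A2 : `|r * Num.sg (u k) * (l k - b * `|w k|) / 2| <
            (l k - b * `|w k|) / 2.
    rewrite normrM [`|2^-1|]ger0_norm ?invr_ge0 // ltr_pM2r ?invr_gt0 //.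
    rewrite normrM (gtr0_norm dk) gtr_pMl // normrM normr_sg.
    have rr : `|r| < 1 by rewrite ltr_norml r2 r1.
    by case: (u k != 0); rewrite ?mulr1 ?mulr0.
  move: A1 A2; rewrite ler_norml ltr_norml /q => /andP[B1 B2] /andP[B3 B4].
  by apply/andP; split; lra.
have qx s : \sum_k q s k * u k + tx = a.
  have -> : \sum_k q s k * u k = (\sum_k l k * u k) / 2 +
      s * b / 2 * (\sum_k u k * w k) + r * e.
    rewrite /e !mulr_suml !mulr_sumr -!big_split /=.
    by apply: eq_bigr => k _; rewrite /q (normrEsg (u k)); ring.
  by rewrite uw re /m; ring.
have qy : \sum_k q 1 k * w k = \sum_k q (-1) k * w k + b.
  have -> : b = b * (\sum_k w k ^+ 2) by rewrite ww mulr1.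
  rewrite mulr_sumr -big_split /=; apply: eq_bigr => k _.
  by rewrite /q; field.
have /andP[_ t1] := H (q 1) (qin 1 (normr1 _)) (qx 1).
have /andP[t2 _] := H (q (-1)) (qin (-1) (normrN1 _)) (qx (-1)).
by move: t1 t2; rewrite qy; lra.
Qed.

(** * Continuity of matrix entries, products and finite maxima *)

Lemma entry_continuous (R : realType) (T : topologicalType) m n
    (f : T -> 'M[R]_(m, n)) i j :
  continuous f -> continuous (fun t => f t i j).
Proof.
move=> cf t; apply: (@continuous_comp _ _ _ f (fun M : 'M[R]_(m, n) => M i j)).
  exact: cf.
exact: coord_continuous.
Qed.

Lemma matrix_continuous (R : realType) (T : topologicalType) m n
    (f : T -> 'M[R]_(m, n)) :
  (forall i j, continuous (fun t => f t i j)) -> continuous f.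
Proof.
move=> cf t A [P fP sPA].
rewrite /nbhs/=; apply: (@filterS _ _ _ _ _ (fun s hs => sPA _ hs)).
apply: filter_forall => i; apply: filter_forall => j.
exact: cf (fP i j).
Qed.

Lemma mulmx_continuous (R : realType) (T : topologicalType) m n p
    (f : T -> 'M[R]_(m, n)) (g : T -> 'M[R]_(n, p)) :
  continuous f -> continuous g -> continuous (fun t => f t *m g t).
Proof.
move=> cf cg; apply: matrix_continuous => i k t.
under eq_fun do rewrite mxE.
apply: cvg_big => [|j _]; first exact: add_continuous.
by apply: cvgM; exact: entry_continuous.
Qed.

Lemma maxr_continuous (R : realType) (T : topologicalType) (f g : T -> R) :
  continuous f -> continuous g -> continuous (fun t => Num.max (f t) (g t)).
Proof. by move=> cf cg t; apply: continuous_max; [exact: cf | exact: cg]. Qed.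

Lemma bigmax_continuous (R : realType) (T : topologicalType) n
    (f : 'I_n -> T -> R) (g : T -> R) :
  continuous g -> (forall i, continuous (f i)) ->
  continuous (fun t => \big[Num.max/g t]_i f i t).
Proof.
move=> cg cf; elim: (index_enum _) => [|i r IH].
  by under eq_fun do rewrite big_nil; exact: cg.
under eq_fun do rewrite big_cons.
by apply: maxr_continuous; [exact: cf | exact: IH].
Qed.

(* If the sets alpha <= 0 and 0 <= beta did not meet, alpha + beta would change
   sign without vanishing. *)
Lemma IVT_pair (R : realType) (alpha beta : R -> R) :
  {within `[0, 1], continuous alpha} -> {within `[0, 1], continuous beta} ->
  alpha 0 <= 0 -> 0 <= beta 1 ->
  (forall t, 0 <= t <= 1 -> alpha t <= 0 \/ 0 <= beta t) ->
  exists2 t, 0 <= t <= 1 & alpha t <= 0 <= beta t.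
Proof.
move=> ca cb a0 b1 cover; apply: contrapT => H.
have ex t : 0 <= t <= 1 -> (alpha t <= 0 -> beta t < 0) /\ (0 <= beta t -> 0 < alpha t).
  move=> t01; split => h; rewrite ltNge; apply/negP => h'; apply: H.
    by exists t; rewrite // h h'.
  by exists t; rewrite // h h'.
have [h0 _] := ex 0 ltac:(by rewrite lexx ler01).
have [_ h1] := ex 1 ltac:(by rewrite lexx ler01).
have cab : {within `[0, 1], continuous (alpha \+ beta)}.
  by move=> t; apply: cvgD; [exact: ca | exact: cb].
have f0 : alpha 0 + beta 0 <= 0 by move: (h0 a0); lra.
have f1 : 0 <= alpha 1 + beta 1 by move: (h1 b1); lra.
have [|t] := @IVT _ _ _ _ 0 (@ler01 R) cab.
  by rewrite /= ge_min f0 le_max f1 orbT.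
rewrite in_itv /= => t01 ft.
have [e1 e2] := ex t t01.
case: (cover t t01) => h; [move: (e1 h) | move: (e2 h)]; lra.
Qed.

(** * Rigid motions, spatial coordinates and the corridors *)

Lemma rm_comp_orthogonal (R : realType) n (g h : rigid_motion R n) :
  (rm_lin h *m rm_lin g) *m (rm_lin h *m rm_lin g)^T = 1%:M.
Proof.
rewrite trmx_mul mulmxA -(mulmxA (rm_lin h)) (rm_orthogonal g) mulmx1.
exact: rm_orthogonal.
Qed.

Definition rm_comp (R : realType) n (g h : rigid_motion R n) :
    rigid_motion R n :=
  @RigidMotion R n (rm_lin h *m rm_lin g)
    (rm_trans h *m rm_lin g + rm_trans g) (rm_comp_orthogonal g h).

Lemma rm_act_comp (R : realType) n (g h : rigid_motion R n) p :
  rm_act (rm_comp g h) p = rm_act g (rm_act h p).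
Proof. by rewrite /rm_act /= mulmxDl mulmxA addrA. Qed.

Lemma rm_actE (R : realType) n (g : rigid_motion R n) p j :
  rm_act g p ord0 j = \sum_k p ord0 k * rm_lin g k j + rm_trans g ord0 j.
Proof. by rewrite /rm_act !mxE. Qed.

(** Absorbs the position of the box into the motion, so that the box itself can be taken
    axis-parallel with a vertex at the origin. *)
Lemma image_box_subset (R : realType) n (P : box R n) g (A : set 'rV[R]_n) :
  rm_act g @` box_set P `<=` A <->
  forall p : 'rV[R]_n, (forall k, 0 < p ord0 k < box_side P k) ->
    A (rm_act (rm_comp g (box_position P)) p).
Proof.
split=> [sA p hp|sA _ [_ [p hp <-] <-]]; rewrite -?rm_act_comp; last exact: sA.
by apply: sA; exists (rm_act (box_position P) p); [exists p | rewrite rm_act_comp].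
Qed.

Lemma rm_path_compr (R : realType) n (Phi : R -> rigid_motion R n) h :
  rm_path Phi -> rm_path (fun t => rm_comp (Phi t) h).
Proof.
move=> [cl ct]; split.
  by apply: mulmx_continuous; [move=> t; exact: cvg_cst | exact: cl].
move=> t; apply: cvgD; last exact: ct.
by apply: mulmx_continuous; [move=> s; exact: cvg_cst | exact: cl].
Qed.

Lemma rm_col_dot (R : realType) n (g : rigid_motion R n) j j' :
  \sum_k rm_lin g k j * rm_lin g k j' = (j == j')%:R.
Proof.
have /matrixP /(_ j j') := mulmx1C (rm_orthogonal g).
by rewrite !mxE => <-; apply: eq_bigr => k _; rewrite mxE.
Qed.

Lemma rm_col_norm (R : realType) n (g : rigid_motion R n) j :
  \sum_k rm_lin g k j ^+ 2 = 1.
Proof.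
by have := rm_col_dot g j j; rewrite eqxx /= mulr1n => <-; apply: eq_bigr.
Qed.

(** Written with shifts to match [lsubmx] and [rsubmx] in [cylinder]. *)
Local Notation ix := (lshift 1 (ord0 : 'I_2) : 'I_3).
Local Notation iy := (lshift 1 (ord_max : 'I_2) : 'I_3).
Local Notation iz := (rshift 2 (ord0 : 'I_1) : 'I_3).

Lemma lsubmx_coords (R : realType) (p : 'rV[R]_3) :
  xc (lsubmx (p : 'rV_(2 + 1))) = p ord0 ix /\
  yc (lsubmx (p : 'rV_(2 + 1))) = p ord0 iy.
Proof. by rewrite /xc /yc; split; rewrite mxE. Qed.

Lemma rm_row_norm3 (R : realType) (g : rigid_motion R 3) k :
  rm_lin g k ix ^+ 2 + rm_lin g k iy ^+ 2 + rm_lin g k iz ^+ 2 = 1.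
Proof.
have /matrixP /(_ k k) := rm_orthogonal g.
rewrite !mxE eqxx (@big_split_ord _ _ _ 2 1) /= !big_ord_recr !big_ord0 /= !add0r mulr1n.
move=> <-; rewrite !mxE -!expr2; congr (rm_lin g k _ ^+ 2 + rm_lin g k _ ^+ 2 + rm_lin g k _ ^+ 2);
  exact: val_inj.
Qed.

(** Extracts the left wall and the door from all eight corridors, which makes the volume estimate
    uniform in [i] and [j]. *)
Lemma regionC_corner (R : realType) (a b : R) i j q : 0 < a ->
  regionC a b i j q -> 0 < xc q /\ (xc q = a -> 0 < yc q < b).
Proof.
move=> ap; have A0 : regionA0 a b q -> 0 < xc q /\ (xc q = a -> 0 < yc q < b).
  by move=> [[-> yq]|/= /andP[x0 xa]] //; split => // e; move: xa; rewrite e ltxx.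
have B0 : regionB0 a b q -> 0 < xc q /\ (xc q = a -> 0 < yc q < b).
  move=> [[-> yq]|/= xa] //; split; first exact: lt_trans xa.
  by move=> e; move: xa; rewrite e ltxx.
case; first by case: i => [[|i] hi] /=; [exact: A0 | case=> /A0].
by case: j => [[|[|[|j]]] hj] /=; [exact: B0 | case=> /B0..].
Qed.

Lemma regionA_le (R : realType) (a b : R) i q : regionA a b i q -> xc q <= a.
Proof.
have A0 : regionA0 a b q -> xc q <= a.
  by move=> [[-> _]|/= /andP[_ /ltW]].
by case: i => [[|i] hi] /=; [exact: A0 | case=> /A0].
Qed.

Lemma regionB_ge (R : realType) (a b : R) j q : regionB a b j q -> a <= xc q.
Proof.
have B0 : regionB0 a b q -> a <= xc q.
  by move=> [[-> _]|/= /ltW].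
by case: j => [[|[|[|j]]] hj] /=; [exact: B0 | case=> /B0..].
Qed.

(** Singles out an arbitrary edge [k], so that the inequalities for numbered edges apply with [k] in
    the special place. *)
Lemma sum3 (V : nmodType) (k : 'I_3) (F : 'I_3 -> V) :
  \sum_i F i = F k + F (lift k ord0) + F (lift k ord_max).
Proof.
rewrite (bigD1_ord _ (isT : predT k)) /= big_ord_recr big_ord1 /= addrA.
by congr (_ + F (lift k _) + F (lift k _)); exact: val_inj.
Qed.

Lemma prod3 (V : comPzRingType) (k : 'I_3) (F : 'I_3 -> V) :
  \prod_i F i = F k * F (lift k ord0) * F (lift k ord_max).
Proof.
rewrite (bigD1_ord _ (isT : predT k)) /= big_ord_recr big_ord1 /= mulrA.
by congr (_ * F (lift k _) * F (lift k _)); exact: val_inj.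
Qed.

(** * The motion around the corner: critical time and vertical edge *)

Section Corner.
Variables (R : realType) (a b c : R) (i : 'I_2) (j : 'I_4).
Hypotheses (ap : 0 < a) (bp : 0 < b) (cp : 0 < c).
Variables (l : 'I_3 -> R) (h : R -> rigid_motion R 3).
Hypotheses (lp : forall k, 0 < l k) (hpath : rm_path h).
Hypothesis hA : forall p : 'rV[R]_3, (forall k, 0 < p ord0 k < l k) ->
  cylinder (regionA a b i) c (rm_act (h 0) p).
Hypothesis hB : forall p : 'rV[R]_3, (forall k, 0 < p ord0 k < l k) ->
  cylinder (regionB a b j) c (rm_act (h 1) p).
Hypothesis hC : forall t, 0 <= t <= 1 ->
  forall p : 'rV[R]_3, (forall k, 0 < p ord0 k < l k) ->
  cylinder (regionC a b i j) c (rm_act (h t) p).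

Let u t k := rm_lin (h t) k ix.
Let w t k := rm_lin (h t) k iy.
Let v t k := rm_lin (h t) k iz.
(** The x-coordinate of the centre of the box at time [t]. *)
Let m t := (\sum_k l k * u t k) / 2 + rm_trans (h t) ord0 ix.
Let e t := (\sum_k (l k - b * `|w t k|) * `|u t k|) / 2.

Let row_in (p : 'I_3 -> R) : (forall k, 0 < p k < l k) ->
  forall k, 0 < (\row_k p k) ord0 k < l k.
Proof. by move=> hp k; rewrite mxE. Qed.

Let coord t (p : 'I_3 -> R) j' :
  rm_act (h t) (\row_k p k) ord0 j' =
  \sum_k p k * rm_lin (h t) k j' + rm_trans (h t) ord0 j'.
Proof. by rewrite rm_actE; congr (_ + _); apply: eq_bigr => k _; rewrite mxE. Qed.

Lemma corner_floor_ceiling t : 0 <= t <= 1 ->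
  let z := (\sum_k l k * v t k) / 2 + rm_trans (h t) ord0 iz in
  let r := (\sum_k l k * `|v t k|) / 2 in
  0 <= z - r /\ z + r <= c.
Proof.
move=> t01 z r.
have hz p : (forall k, 0 < p k < l k) ->
    0 < \sum_k p k * v t k + rm_trans (h t) ord0 iz < c.
  by move=> /row_in /(hC t01) [_]; rewrite mxE coord.
split; [apply: box_affine_ge => // p | apply: box_affine_le => // p].
  by move=> /hz /andP[/ltW].
by move=> /hz /andP[_ /ltW].
Qed.

Lemma corner_height t : 0 <= t <= 1 -> \sum_k l k * `|v t k| <= c.
Proof. by move=> /corner_floor_ceiling /=; lra. Qed.

Lemma corner_wall t : 0 <= t <= 1 -> 0 <= m t - (\sum_k l k * `|u t k|) / 2.
Proof.
move=> t01; apply: box_affine_ge => // p /row_in /(hC t01) [hp _].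
by have [+ _] := regionC_corner ap hp; rewrite /xc mxE coord => /ltW.
Qed.

Lemma corner_start : m 0 + (\sum_k l k * `|u 0 k|) / 2 <= a.
Proof.
apply: box_affine_le => // p /row_in /hA [/regionA_le + _].
by rewrite /xc mxE coord.
Qed.

Lemma corner_finish : a <= m 1 - (\sum_k l k * `|u 1 k|) / 2.
Proof.
apply: box_affine_ge => // p /row_in /hB [/regionB_ge + _].
by rewrite /xc mxE coord.
Qed.

Lemma corner_chord t : 0 <= t <= 1 -> (forall k, b * `|w t k| < l k) ->
  0 < e t /\ (m t + e t <= a \/ a <= m t - e t).
Proof.
move=> t01 hl; apply: (doorway_chord (ty := rm_trans (h t) ord0 iy)) => //.
- exact: rm_col_dot.
- exact: rm_col_norm.
- exact: rm_col_norm.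
move=> p /row_in /(hC t01) [hp _]; have [_ +] := regionC_corner ap hp.
have [-> ->] := lsubmx_coords (rm_act (h t) (\row_k p k)).
by rewrite !coord.
Qed.

Let cu k : {within `[0, 1], continuous (fun t => u t k)}.
Proof. by case: hpath => cl _; apply: entry_continuous; exact: cl. Qed.
Let cw k : {within `[0, 1], continuous (fun t => w t k)}.
Proof. by case: hpath => cl _; apply: entry_continuous; exact: cl. Qed.
Let cm : {within `[0, 1], continuous m}.
Proof.
case: hpath => _ ct t; apply: cvgD; last by apply: entry_continuous; exact: ct.
apply: cvgM; last exact: cvg_cst.
apply: cvg_big => [|k _]; first exact: add_continuous.
by apply: cvgM; [exact: cvg_cst | exact: cu].
Qed.
Let cbw k : {within `[0, 1], continuous (fun t => b * `|w t k|)}.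
Proof.
by move=> t; apply: cvgM; [exact: cvg_cst | apply: cvg_norm; exact: cw].
Qed.
Let ce : {within `[0, 1], continuous e}.
Proof.
move=> t; apply: cvgM; last exact: cvg_cst.
apply: cvg_big => [|k _]; first exact: add_continuous.
apply: cvgM; last by apply: cvg_norm; exact: cu.
by apply: cvgB; [exact: cvg_cst | exact: cbw].
Qed.

Lemma corner_critical_time :
  (exists k, l k <= b * `|w 0 k|) \/
  exists t, [/\ 0 <= t <= 1, m t + e t <= a,
    forall k, b * `|w t k| <= l k & exists k, l k = b * `|w t k|].
Proof.
pose f k t := b * `|w t k| - l k.
(* The default value is one of the terms, so the sign of [H t] is decided by the [f k t] alone. *)
pose H t := \big[Num.max/f ord0 t]_k f k t.
have Hle t : H t <= 0 -> forall k, b * `|w t k| <= l k.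
  by move=> /bigmax_leP[_ h0] k; have := h0 k isT; rewrite subr_le0.
have Hlt t : H t < 0 -> forall k, b * `|w t k| < l k.
  by move=> /bigmax_ltP[_ h0] k; have := h0 k isT; rewrite subr_lt0.
have Hge t : 0 <= H t -> exists k, l k <= b * `|w t k|.
  move=> H0; apply: contrapT => hn; move: H0; rewrite leNgt => /negP; apply.
  have nk k : f k t < 0.
    by rewrite subr_lt0 ltNge; apply/negP => lk; apply: hn; exists k.
  by apply/bigmax_ltP; split.
have cf k : {within `[0, 1], continuous (f k)}.
  by move=> t; apply: cvgB; [exact: cbw | exact: cvg_cst].
have cH : {within `[0, 1], continuous H}.
  by apply: bigmax_continuous; [exact: cf | move=> k; exact: cf].
case: (leP 0 (H 0)) => [/Hge|H0]; [by left | right].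
have t00 : 0 <= (0 : R) <= 1 by rewrite lexx ler01.
have t11 : 0 <= (1 : R) <= 1 by rewrite lexx ler01.
(* alpha <= 0: the part filled by y-parallel segments of length b is left of
   the door; 0 <= beta: it is right of the door or some b|w_k| >= l_k. *)
pose alpha t := Num.max (m t + e t - a) (H t).
pose beta t := Num.max (H t) (m t - e t - a).
have up0 t : 0 <= \sum_k l k * `|u t k|.
  by apply: sumr_ge0 => k _; rewrite mulr_ge0 // ltW.
have [||||t t01|t t01] := @IVT_pair R alpha beta.
- apply: maxr_continuous; last exact: cH.
  move=> t; by apply: cvgB; [apply: cvgD; [exact: cm | exact: ce] | exact: cvg_cst].
- apply: maxr_continuous; first exact: cH.
  move=> t; by apply: cvgB; [apply: cvgB; [exact: cm | exact: ce] | exact: cvg_cst].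
- rewrite ge_max (ltW H0) andbT; have [e0 [|]] := corner_chord t00 (Hlt _ H0).
    by lra.
  by have := corner_start; have := up0 0; lra.
- rewrite le_max; case: (leP 0 (H 1)) => //= H1.
  have [e1 [|]] := corner_chord t11 (Hlt _ H1); last by lra.
  by have := corner_finish; have := up0 1; lra.
- rewrite ge_max le_max; case: (leP 0 (H t)) => /= Ht; first by right.
  have [_ [|]] := corner_chord t01 (Hlt _ Ht); last by right; lra.
  by left; rewrite (ltW Ht) andbT; lra.
rewrite ge_max le_max => /andP[/andP[h1 h2] h3]; exists t.
(* If [H t] were negative, both m + e <= a and a <= m - e would hold, against e > 0. *)
have ht : 0 <= H t.
  case/orP: h3 => // h3; rewrite leNgt; apply/negP => Ht.
  by have [e0 _] := corner_chord t01 (Hlt _ Ht); lra.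
split => //; [by lra | exact: Hle |].
have [k lk] := Hge _ ht; exists k; apply/eqP; rewrite eq_le lk.
exact: Hle.
Qed.

Lemma corner_upright : a * b * c <= \prod_k l k ->
  a * b * c = \prod_k l k /\
  exists t k, [/\ 0 <= t <= 1, `|v t k| = 1 & l k = c].
Proof.
move=> hV.
have t00 : 0 <= (0 : R) <= 1 by rewrite lexx ler01.
have key t (k : 'I_3) : 0 <= t <= 1 ->
    l (lift k ord0) * `|u t (lift k ord0)| <= a ->
    l (lift k ord_max) * `|u t (lift k ord_max)| <= a ->
    (v t k = 0 -> l (lift k ord0) * `|u t (lift k ord0)| = a ->
       l (lift k ord_max) * `|u t (lift k ord_max)| = a -> False) ->
    l k <= b * `|w t k| ->
  a * b * c = \prod_k l k /\
  exists t k, [/\ 0 <= t <= 1, `|v t k| = 1 & l k = c].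
  move=> t01 x2 x3 ne hw; rewrite (prod3 k) in hV *.
  have n j' := rm_col_norm (h t) j'.
  have d := rm_col_dot (h t) ix iz.
  have z := corner_height t01; rewrite (sum3 k) in z.
  have [||//|-> [[? ?]|[? ?]]] := upright_of_volume (lp k) (lp (lift k ord0))
    (lp (lift k ord_max)) ap bp cp (rm_row_norm3 (h t) k) _ _ _ z x2 x3 ne hw hV.
  - by rewrite -[RHS](n ix) (sum3 k).
  - by rewrite -[RHS](n iz) (sum3 k).
  - by have := d; rewrite (sum3 k).
  - by split => //; exists t, (lift k ord0).
  - by split => //; exists t, (lift k ord_max).
case: corner_critical_time => [[k lk]|[t [t01 hm hl [k lk]]]].
  (* At time 0 the whole box lies between the wall x = 0 and the door, so all three x-extents
     together are at most [a] and no two of them can equal [a]. *)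
  have hu : \sum_k l k * `|u 0 k| <= a.
    by have := corner_start; have := corner_wall t00; lra.
  have X0 k' : 0 <= l k' * `|u 0 k'| by rewrite mulr_ge0 // ltW.
  rewrite (sum3 k) in hu; have x1 := X0 k; have x2 := X0 (lift k ord0).
  have x3 := X0 (lift k ord_max).
  have y2 : l (lift k ord0) * `|u 0 (lift k ord0)| <= a by lra.
  have y3 : l (lift k ord_max) * `|u 0 (lift k ord_max)| <= a by lra.
  have y : l (lift k ord0) * `|u 0 (lift k ord0)| = a ->
    l (lift k ord_max) * `|u 0 (lift k ord_max)| = a -> False.
    move=> y4 y5; suff : a <= 0 by rewrite leNgt ap.
    by move: hu; rewrite y4 y5; lra.
  exact: (key 0 k t00 y2 y3 (fun=> y) lk).
have hw := corner_wall t01; rewrite /e in hm.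
rewrite (sum3 k) in hw; rewrite (sum3 k) in hm.
have n := rm_col_norm (h t) iy; rewrite (sum3 k) in n.
have d := rm_col_dot (h t) ix iy; rewrite (sum3 k) in d.
have [x2 x3 ne] := doorway_extents (lp k) (lp (lift k ord0))
  (lp (lift k ord_max)) ap bp (rm_row_norm3 (h t) k) n d hw hm lk (hl _) (hl _).
by apply: (key t k) => //; rewrite lk.
Qed.

(** By [upright_gap] the continuous function |v_k| omits the values strictly between [1 - r] and 1;
    leaving 1 it would have to pass through [1 - r / 2]. *)
Lemma corner_stays_upright t0 k : 0 <= t0 <= 1 -> `|v t0 k| = 1 -> l k = c ->
  forall t, 0 <= t <= 1 -> `|v t k| = 1.
Proof.
move=> t001 vt0 lk t t01.
set l1 := l (lift k ord0); set l2 := l (lift k ord_max).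
pose d := Num.min l1 l2.
have dp : 0 < d by rewrite lt_min !lp.
have gap s : 0 <= s <= 1 -> `|v s k| = 1 \/ `|v s k| <= 1 - d ^+ 2 / c ^+ 2.
  move=> s01; have z := corner_height s01; rewrite (sum3 k) lk -addrA in z.
  have n := rm_col_norm (h s) iz; rewrite (sum3 k) -addrA addrC in n.
  by apply: (upright_gap dp _ _ cp n z); rewrite ge_min lexx ?orbT.
set r := d ^+ 2 / c ^+ 2 in gap.
have rp : 0 < r by rewrite divr_gt0 ?exprn_gt0.
case: (gap t t01) => // vt.
have cv : {within `[0, 1], continuous (fun t => `|v t k|)}.
  move=> s; apply: cvg_norm; case: hpath => cl _.
  by apply: entry_continuous; exact: cl.
have [x x01 hx] : exists2 x, 0 <= x <= 1 & `|v x k| = 1 - r / 2.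
  have sub (x y : R) : 0 <= x <= 1 -> 0 <= y <= 1 -> x <= y ->
      {within `[x, y], continuous (fun t => `|v t k|)}.
    move=> /andP[x0 _] /andP[_ y1] xy; apply: continuous_subspaceW cv => z /=.
    by rewrite !in_itv /= => /andP[/(le_trans x0) -> /le_trans ->].
  case: (leP t0 t) => [tt|/ltW tt].
    have [|x] := IVT (v := 1 - r / 2) tt (sub _ _ t001 t01 tt).
      by rewrite ge_min le_max vt0; apply/andP; split; apply/orP; [right|left]; lra.
    rewrite in_itv /= => /andP[x1 x2] hx; exists x => //.
    move/andP: t001 => [/le_trans ->//]; move/andP: t01 => [_ /(le_trans x2) ->//].
  have [|x] := IVT (v := 1 - r / 2) tt (sub _ _ t01 t001 tt).
    by rewrite ge_min le_max vt0; apply/andP; split; apply/orP; [left|right]; lra.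
  rewrite in_itv /= => /andP[x1 x2] hx; exists x => //.
  by move/andP: t01 => [/le_trans ->//]; move/andP: t001 => [_ /(le_trans x2) ->//].
by case: (gap x x01); rewrite hx; lra.
Qed.

End Corner.

(** * Lifting planar boxes and motions to the spatial corridor *)

Lemma rm_inv_orthogonal (R : realType) n (g : rigid_motion R n) :
  (rm_lin g)^T *m ((rm_lin g)^T)^T = 1%:M.
Proof. by rewrite trmxK; apply: mulmx1C; exact: rm_orthogonal. Qed.

Definition rm_inv (R : realType) n (g : rigid_motion R n) : rigid_motion R n :=
  @RigidMotion R n (rm_lin g)^T (- rm_trans g *m (rm_lin g)^T)
    (rm_inv_orthogonal g).

Lemma rm_invK (R : realType) n (g : rigid_motion R n) p :
  rm_act (rm_inv g) (rm_act g p) = p.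
Proof.
by rewrite /rm_act /= -mulmxDl addrK -mulmxA (rm_orthogonal g) mulmx1.
Qed.

Lemma mul_tr1mx (R : realType) n : (1%:M : 'M[R]_n) *m 1%:M^T = 1%:M.
Proof. by rewrite trmx1 mulmx1. Qed.

Definition rm_translation (R : realType) n (s : 'rV[R]_n) : rigid_motion R n :=
  RigidMotion s (mul_tr1mx R n).

Lemma rm_lift_orthogonal (R : realType) (g : rigid_motion R 2) :
  block_mx (rm_lin g) 0 0 (1%:M : 'M[R]_1) *m
    (block_mx (rm_lin g) 0 0 (1%:M : 'M[R]_1))^T = 1%:M.
Proof.
rewrite tr_block_mx mulmx_block !(trmx0, trmx1, mulmx0, mul0mx, mulmx1).
by rewrite !(addr0, add0r) (rm_orthogonal g) -scalar_mx_block.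
Qed.

Definition rm_lift (R : realType) (g : rigid_motion R 2) : rigid_motion R 3 :=
  @RigidMotion R (2 + 1) (block_mx (rm_lin g) 0 0 1%:M)
    (row_mx (rm_trans g) 0) (rm_lift_orthogonal g).

Lemma rm_act_lift (R : realType) (g : rigid_motion R 2) (p : 'rV[R]_(2 + 1)) :
  rm_act (rm_lift g) p = row_mx (rm_act g (lsubmx p)) (rsubmx p).
Proof.
have e : p *m block_mx (rm_lin g) 0 0 1%:M =
    row_mx (lsubmx p *m rm_lin g) (rsubmx p).
  by rewrite -{1}[p]hsubmxK mul_row_block !mulmx0 mulmx1 add0r addr0.
have -> : rm_act (rm_lift g) p =
    row_mx (lsubmx p *m rm_lin g) (rsubmx p) + row_mx (rm_trans g) 0.
  exact: (congr1 (fun q : 'rV_(2 + 1) => q + row_mx (rm_trans g) 0) e).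
by rewrite add_row_mx addr0.
Qed.

Definition cylinder_side (R : realType) (s : 'I_2 -> R) (c : R)
    (k : 'I_(2 + 1)) : R :=
  match fintype.split k with inl i => s i | inr _ => c end.

Lemma cylinder_side_gt0 (R : realType) (s : 'I_2 -> R) c :
  (forall k, 0 < s k) -> 0 < c -> forall k, 0 < cylinder_side s c k.
Proof. by move=> sp cp k; rewrite /cylinder_side; case: fintype.split. Qed.

Definition box_lift (R : realType) (c : R) (cp : 0 < c) (Q : box R 2) :
    box R 3 :=
  @Box R 3 (cylinder_side (box_side Q) c)
    (cylinder_side_gt0 (@box_side_gt0 R 2 Q) cp) (rm_lift (box_position Q)).

Lemma volume_box_lift (R : realType) (c : R) (cp : 0 < c) Q :
  volume (box_lift cp Q) = volume Q * c.
Proof.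
rewrite /volume /= (@big_split_ord _ _ _ 2 1) /= big_ord1.
congr (_ * _); last by rewrite /cylinder_side (unsplitK (inr _)).
by apply: eq_bigr => x _; rewrite /cylinder_side (unsplitK (inl _)).
Qed.

Lemma rm_path_lift (R : realType) (Phi : R -> rigid_motion R 2) :
  rm_path Phi -> rm_path (fun t => rm_lift (Phi t)).
Proof.
move=> [cl ct]; split; apply: matrix_continuous => x y.
  case: (@split_ordP 2 1 x) => x' ->; case: (@split_ordP 2 1 y) => y' -> /=.
  - rewrite (_ : (fun _ => _) = fun t => rm_lin (Phi t) x' y').
      by apply: entry_continuous; exact: cl.
    by apply/funext => t; exact: block_mxEul.
  - rewrite (_ : (fun _ => _) = fun=> (0 : 'M[R]_(2, 1)) x' y').
      by move=> t; exact: cvg_cst.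
    by apply/funext => t; exact: block_mxEur.
  - rewrite (_ : (fun _ => _) = fun=> (0 : 'M[R]_(1, 2)) x' y').
      by move=> t; exact: cvg_cst.
    by apply/funext => t; exact: block_mxEdl.
  - rewrite (_ : (fun _ => _) = fun=> (1%:M : 'M[R]_1) x' y').
      by move=> t; exact: cvg_cst.
    by apply/funext => t; exact: block_mxEdr.
case: (@split_ordP 2 1 y) => y' -> /=.
  rewrite (_ : (fun _ => _) = fun t => rm_trans (Phi t) x y').
    by apply: entry_continuous; exact: ct.
  by apply/funext => t; exact: row_mxEl.
rewrite (_ : (fun _ => _) = fun=> (0 : 'M[R]_1) x y').
  by move=> t; exact: cvg_cst.
by apply/funext => t; exact: row_mxEr.
Qed.

(** Serves twice: for the lower bound on the maximal volume, and to carry maximality from the box to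
    its base. *)
Lemma spatial_movable_lift (R : realType) (a b c : R) i j (cp : 0 < c) Q :
  planar_movable a b i j Q -> spatial_movable a b c i j (box_lift cp Q).
Proof.
move=> [Phi [cPhi hA hB hC]]; exists (fun t => rm_lift (Phi t)).
have lift_subset t (S : set 'rV[R]_2) : rm_act (Phi t) @` box_set Q `<=` S ->
    rm_act (rm_lift (Phi t)) @` box_set (box_lift cp Q) `<=` cylinder S c.
  move=> /image_box_subset hS; apply/image_box_subset => p hp.
  rewrite rm_act_comp /= !rm_act_lift row_mxKl row_mxKr; split.
    rewrite row_mxKl -rm_act_comp; apply: hS => x; rewrite mxE.
    by have := hp (lshift 1 x); rewrite /= /cylinder_side (unsplitK (inl _)).
  rewrite row_mxKr mxE.
  by have := hp (rshift 2 ord0); rewrite /= /cylinder_side (unsplitK (inr _)).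
split; [exact: rm_path_lift | exact: lift_subset | exact: lift_subset |].
by move=> t /hC; exact: lift_subset.
Qed.

(** The rectangle with sides [a] and [b] slides horizontally from 0 < x < a to a < x < 2a within 0 <
    y < b, a strip that every corridor contains for x > 0. *)
Lemma planar_movable_rectangle (R : realType) (a b : R) i j :
  0 < a -> 0 < b -> exists2 Q, planar_movable a b i j Q & volume Q = a * b.
Proof.
move=> ap bp; pose s (x : 'I_2) := if x == ord0 then a else b.
have sp x : 0 < s x by rewrite /s; case: ifP.
exists (Box sp (rm_translation 0)); last by rewrite /volume big_ord_recl big_ord1.
have coords t (p : 'rV[R]_2) : (forall x, 0 < p ord0 x < s x) ->
    let q := rm_act (rm_comp (rm_translation (\row_x (if x == ord0 then t * a else 0)))
      (rm_translation 0)) p in t * a < xc q < t * a + a /\ 0 < yc q < b.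
  move=> hp; rewrite rm_act_comp /rm_act /= !mulmx1 addr0 /xc /yc !mxE /=.
  have := hp ord0; have := hp ord_max; rewrite /s /=; lra.
exists (fun t => rm_translation (\row_x (if x == ord0 then t * a else 0))).
have A0 q : 0 < xc q < a -> 0 < yc q < b -> regionA a b i q.
  move=> hx hy; rewrite /regionA; case: (val i); first by right.
  by split; [right | move: hy => /andP[]].
have Bx q : a <= xc q -> 0 < yc q < b -> regionB a b j q.
  move=> hx hy.
  have B0 : regionB0 a b q.
    by move: hx; rewrite le_eqVlt => /orP[/eqP hx|hx]; [left | right].
  move: (hy) => /andP[hy0 hyb].
  by rewrite /regionB; case: (val j) => [|[|[|?]]] //; split.
split.
- split; first by move=> t; exact: cvg_cst.
  apply: matrix_continuous => x y.
  rewrite (_ : (fun _ => _) = fun t => if y == ord0 then t * a else 0).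
    apply: continuous_subspaceT; case: (y == ord0) => t; last exact: cvg_cst.
    by apply: cvgM; [exact: cvg_id | exact: cvg_cst].
  by apply/funext => t; rewrite mxE.
- by apply/image_box_subset => p /= /(coords 0) /= [hx hy]; apply: A0 => //; lra.
- by apply/image_box_subset => p /= /(coords 1) /= [hx hy]; apply: Bx => //; lra.
move=> t /andP[t0 t1]; apply/image_box_subset => p /= /(coords t) /=.
set q := rm_act _ _ => -[hx hy]; have ta : 0 <= t * a by rewrite mulr_ge0 // ltW.
case: (ltP (xc q) a) => hxa; [left; apply: A0 => // | right; exact: Bx].
by rewrite hxa andbT; move: hx => /andP[/(le_lt_trans ta)].
Qed.

(** * Projecting the motion of a box with a vertical edge to the plane *)

Section Upright.
Variables (R : realType) (k : 'I_3).

Lemma upright_col0 (g : rigid_motion R 3) x : `|rm_lin g k iz| = 1 ->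
  rm_lin g (lift k x) iz = 0.
Proof.
move=> vk; have := rm_col_norm g iz; rewrite (bigD1_ord _ (isT : predT k)) /=.
have -> : rm_lin g k iz ^+ 2 = 1 by rewrite -real_normK ?num_real // vk expr1n.
move/eqP; rewrite -subr_eq0 addrAC subrr add0r => /eqP.
move=> /psumr_eq0P h; apply/eqP; rewrite -sqrf_eq0; apply/eqP.
by apply: h => // y _; exact: sqr_ge0.
Qed.

Lemma upright_sum (g : rigid_motion R 3) (l : 'I_3 -> R) :
  `|rm_lin g k iz| = 1 ->
  \sum_x l x * rm_lin g x iz = l k * rm_lin g k iz.
Proof.
move=> vk; rewrite (bigD1_ord _ (isT : predT k)) /= big1 ?addr0 // => x _.
by rewrite upright_col0 // mulr0.
Qed.

Lemma upright_sum_norm (g : rigid_motion R 3) (l : 'I_3 -> R) :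
  `|rm_lin g k iz| = 1 -> \sum_x l x * `|rm_lin g x iz| = l k.
Proof.
move=> vk; rewrite (bigD1_ord _ (isT : predT k)) /= vk mulr1.
by rewrite big1 ?addr0 // => x _; rewrite upright_col0 // normr0 mulr0.
Qed.

Lemma upright_row0 (g : rigid_motion R 3) (y : 'I_2) : `|rm_lin g k iz| = 1 ->
  rm_lin g k (lshift 1 y : 'I_(2 + 1)) = 0.
Proof.
move=> vk; have := rm_row_norm3 g k.
have -> : rm_lin g k iz ^+ 2 = 1 by rewrite -real_normK ?num_real // vk expr1n.
have := sqr_ge0 (rm_lin g k ix); have := sqr_ge0 (rm_lin g k iy) => h1 h2 h3.
apply/eqP; rewrite -sqrf_eq0 eq_le sqr_ge0 andbT.
have [->|->] : y = ord0 \/ y = ord_max; last 2 first.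
- by lra.
- by lra.
by case: y => [[|[|?]]] // ?; [left | right]; exact: val_inj.
Qed.

(** Horizontal components of the two edges other than [k]. When edge [k] is vertical, the deleted
    row and column meet in an entry of modulus 1 and vanish elsewhere, so this block is
    orthogonal. *)
Let plin (g : rigid_motion R 3) : 'M[R]_2 :=
  \matrix_(x, y) rm_lin g (lift k x) (lshift 1 y : 'I_(2 + 1)).

Lemma upright_orthogonal g : `|rm_lin g k iz| = 1 -> plin g *m (plin g)^T = 1%:M.
Proof.
move=> vk; apply/matrixP => x y; rewrite !mxE.
have /matrixP /(_ (lift k x) (lift k y)) := rm_orthogonal g.
rewrite !mxE (@big_split_ord _ _ _ 2 1) /= big_ord1 upright_col0 // mul0r addr0.
rewrite (inj_eq (@lift_inj _ k)) => <-.
by apply: eq_bigr => z _; rewrite !mxE.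
Qed.

(* Junk value (the identity) unless the k-th edge is vertical. *)
Definition rm_plan (g : rigid_motion R 3) : rigid_motion R 2 :=
  match pselect (plin g *m (plin g)^T = 1%:M) with
  | left H => RigidMotion (lsubmx (rm_trans g : 'rV_(2 + 1))) H
  | right _ => rm_translation 0
  end.

Lemma rm_planE g : `|rm_lin g k iz| = 1 ->
  rm_lin (rm_plan g) = plin g /\
  rm_trans (rm_plan g) = lsubmx (rm_trans g : 'rV_(2 + 1)).
Proof. by move=> /upright_orthogonal H; rewrite /rm_plan; case: pselect. Qed.

Lemma lsubmx_act g (p : 'rV[R]_3) : `|rm_lin g k iz| = 1 ->
  lsubmx (rm_act g p : 'rV_(2 + 1)) =
  rm_act (rm_plan g) (\row_x p ord0 (lift k x)).
Proof.
move=> vk; have [e1 e2] := rm_planE vk; apply/rowP => y.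
rewrite mxE rm_actE rm_actE e1 e2 (bigD1_ord _ (isT : predT k)) /=.
rewrite upright_row0 // mulr0 add0r [lsubmx _ _ _]mxE; congr (_ + _).
by apply: eq_bigr => x _; rewrite !mxE.
Qed.

Lemma rm_path_plan (h : R -> rigid_motion R 3) : rm_path h ->
  (forall t, 0 <= t <= 1 -> `|rm_lin (h t) k iz| = 1) ->
  rm_path (fun t => rm_plan (h t)).
Proof.
move=> [cl ct] up; split.
  (* [rm_plan] is defined by cases; on [0, 1] it agrees with the matrix [plin], whose entries are
     continuous. *)
  apply: (@subspace_eq_continuous _ _ _ (fun t => plin (h t))).
    move=> t; rewrite inE /= in_itv /= => t01.
    exact: (esym (rm_planE (up t t01)).1).
  apply: matrix_continuous => x y.
  rewrite (_ : (fun _ => _) =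
    fun t => rm_lin (h t) (lift k x) (lshift 1 y : 'I_(2 + 1))).
    by apply: entry_continuous; exact: cl.
  by apply/funext => t; rewrite mxE.
apply: (@subspace_eq_continuous _ _ _
    (fun t => lsubmx (rm_trans (h t) : 'rV_(2 + 1)))).
  move=> t; rewrite inE /= in_itv /= => t01.
  exact: (esym (rm_planE (up t t01)).2).
apply: matrix_continuous => x y.
rewrite (_ : (fun _ => _) =
  fun t => rm_trans (h t) x (lshift 1 y : 'I_(2 + 1))).
  by apply: entry_continuous; exact: ct.
by apply/funext => t; rewrite mxE.
Qed.

End Upright.

(** * From the maximal box to its rectangular base *)

Lemma insert_coord (R : realType) (k : 'I_3) (l : 'I_3 -> R) (p : 'rV[R]_2) z :
  0 < z < l k -> (forall x, 0 < p ord0 x < l (lift k x)) ->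
  exists q : 'rV[R]_3, [/\ q ord0 k = z, \row_x q ord0 (lift k x) = p
    & forall y, 0 < q ord0 y < l y].
Proof.
move=> hz hp.
exists (\row_y (if unlift k y is Some x then p ord0 x else z)); split.
- by rewrite mxE unlift_none.
- by apply/rowP => x; rewrite !mxE liftK.
by move=> y; rewrite mxE; case: unliftP => [x|] ->.
Qed.

Theorem theorem4 (R : realType) (a b c : R) (i : 'I_2) (j : 'I_4)
    (ha : 0 < a) (hb : 0 < b) (hc : 0 < c) (P : box R 3)
    (hP : max_volume (spatial_movable a b c i j) P) :
  volume P = a * b * c /\
  exists Q : box R 2,
    max_volume (planar_movable a b i j) Q /\
    exists g : rigid_motion R 3,
      rm_act g @` box_set P = cylinder (box_set Q) c.
Proof.
case: hP => [[Phi [cPhi hA hB hC]] hmax].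
pose l := box_side P.
pose h (t : R) : rigid_motion R 3 := rm_comp (Phi t) (box_position P).
have lp : forall k, 0 < l k by exact: box_side_gt0.
have ch : rm_path h by exact: rm_path_compr.
have {}hA := (image_box_subset _ _ _).1 hA.
have {}hB := (image_box_subset _ _ _).1 hB.
have {}hC t t01 := (image_box_subset _ _ _).1 (hC t t01).
(* The lifted rectangle of area [a * b] competes with [P]. *)
have hV : a * b * c <= volume P.
  have [Q0 mQ0 <-] := planar_movable_rectangle i j ha hb.
  by rewrite -(volume_box_lift hc); apply: hmax; exact: spatial_movable_lift.
have [Veq [t0 [k [t01 vk lk]]]] :=
  corner_upright ha hb hc lp ch hA hB hC hV.
have up := corner_stays_upright hc lp ch hC t01 vk lk.
split; first by rewrite Veq.
pose g2 t := rm_plan k (h t).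
(* The base is taken in its position at time 0; its motion is therefore [g2 t] after the inverse of
   [g2 0]. *)
pose Q := @Box R 2 (fun x => l (lift k x)) (fun x => lp _) (g2 0).
have volQ : volume P = volume Q * c.
  by rewrite /volume (bigD1_ord _ (isT : predT k)) /= -/l lk mulrC.
have t00 : 0 <= (0 : R) <= 1 by rewrite lexx ler01.
have t11 : 0 <= (1 : R) <= 1 by rewrite lexx ler01.
have project t (S : set 'rV[R]_2) : 0 <= t <= 1 ->
    (forall p : 'rV[R]_3, (forall x, 0 < p ord0 x < l x) ->
      cylinder S c (rm_act (h t) p)) ->
    rm_act (rm_comp (g2 t) (rm_inv (g2 0))) @` box_set Q `<=` S.
  move=> ht hS; apply/image_box_subset => p hp.
  (* Any interior coordinate along the vertical edge would do; the midpoint is chosen. *)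
  have hz : 0 < c / 2 < l k by rewrite lk; lra.
  have [q [_ qp hq]] := insert_coord hz hp.
  rewrite !rm_act_comp rm_invK -qp -lsubmx_act; last exact: up.
  by have [] := hS q hq.
exists Q; split; first split.
- exists (fun t => rm_comp (g2 t) (rm_inv (g2 0))); split.
  + by apply: rm_path_compr; exact: rm_path_plan.
  + exact: project.
  + exact: project.
  + by move=> t ht; apply: project => //; exact: hC.
- move=> Q' mQ'; rewrite -(ler_pM2r hc) -volQ -(volume_box_lift hc).
  by apply: hmax; exact: spatial_movable_lift.
exists (Phi 0); apply/seteqP; split.
  apply/image_box_subset => p hp; have [_ hz] := hA p hp; split => //.
  exists (\row_x p ord0 (lift k x)); last by rewrite -lsubmx_act //; exact: up.
  by move=> x; rewrite mxE.
move=> q [[p hp hq] hz].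
set z := rsubmx (q : 'rV_(2 + 1)) ord0 ord0 in hz.
set vz := rm_lin (h 0) k iz; set tz := rm_trans (h 0) ord0 iz.
have vz1 : `|vz| = 1 by exact: up.
have vz2 : vz * vz = 1 by rewrite -expr2 -real_normK ?num_real // vz1 expr1n.
(* A box of vertical extent [c] touches floor and ceiling, so its centre is at height [c / 2]. *)
have mid : c * vz / 2 + tz = c / 2.
  have [] := corner_floor_ceiling lp hC t00.
  rewrite (upright_sum_norm l (up 0 t00)) (upright_sum l (up 0 t00)).
  by rewrite -/vz -/tz lk; lra.
(* The coordinate along edge [k] of the point at height [z]: it solves [s * vz + tz = z], and is the
   reflection of [z] in [c / 2] when [vz = -1]. *)
pose s := vz * (z - c / 2) + c / 2.
have hs : 0 < s < l k.
  have : `|vz * (z - c / 2)| < c / 2.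
    by rewrite normrM vz1 mul1r ltr_norml; move: hz; lra.
  by rewrite lk ltr_norml /s; lra.
have [p3 [p3k p3p hp3]] := insert_coord hs hp.
exists (rm_act (box_position P) p3); first by exists p3.
rewrite -rm_act_comp -/(h 0).
have ext (x y : 'rV[R]_(2 + 1)) : lsubmx x = lsubmx y ->
    rsubmx x ord0 ord0 = rsubmx y ord0 ord0 -> x = y.
  move=> e1 e2; rewrite -[x]hsubmxK -[y]hsubmxK e1; congr row_mx.
  by apply/rowP => t; rewrite (ord1 t).
apply: ext; first by rewrite (lsubmx_act (k := k)) ?p3p //; exact: up.
rewrite -/z mxE rm_actE.
rewrite (upright_sum (p3 ord0) (up 0 t00)).
rewrite p3k -/vz -/tz /s.
have -> : (vz * (z - c / 2) + c / 2) * vz + tz =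
  (vz * vz) * (z - c / 2) + (c * vz / 2 + tz) by ring.
by rewrite vz2 mid; ring.
Qed.
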